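(* Let $s<t$ be relatively prime positive integers. Let $\Delta$ be any $(s,t)$-closed delta-set and $\beta$ any $(s,t)$-closed beta-set such that $\beta\subset\Delta$. Then $\beta\prec\Delta$.
   Context: A beta-set is a finite set of positive integers, written in decreasing order $\beta=\{\beta_1>\dots>\beta_n\}$; its associated partition is $P(\beta)=(\beta_1-(n-1),\beta_2-(n-2),\dots,\beta_n)$. For partitions $P=(P_1,\dots,P_n)$, $Q=(Q_1,\dots,Q_m)$ (finite non-increasing sequences of positive integers) write $P<Q$ if $n\le m$ and $P_i\le Q_i$ for all $i\le n$; for beta-sets $\beta\prec\gamma$ means $P(\beta)<P(\gamma)$. A beta-set $\beta$ is $(s,t)$-closed if for every $x\in\beta$: $x>s$ implies $x-s\in\beta$, and $x>t$ implies $x-t\in\beta$. The $(s,t)$-closure of a set $\beta$ of positive integers is $\overline{\beta}=\{x-as-bt : x\in\beta,\ a,b\ge0,\ x>as+bt\}$. A delta-set is a set of the form $\overline{\{n\}}$ for a positive integer $n$ (its generator). *)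

(* Defs.v *)
From mathcomp Require Import all_boot.

Set Implicit Arguments.
Unset Strict Implicit.
Unset Printing Implicit Defensive.

(* A finite set of positive integers, encoded by the list of its elements in
   strictly decreasing order; each such set has exactly one encoding. *)
Definition beta_set (b : seq nat) : bool := sorted gtn b && all (ltn 0) b.

(* With indices starting at 0, entry i is b_i - (n - 1 - i), where n = size b.
   The subtraction never truncates when b is a beta-set. *)
Definition partition_of (b : seq nat) : seq nat :=
  mkseq (fun i => nth 0 b i - (size b - i.+1)) (size b).

(* The order written P < Q on partitions; it is reflexive. *)
Definition part_le (P Q : seq nat) : Prop :=
  size P <= size Q /\ forall i, i < size P -> nth 0 P i <= nth 0 Q i.

Definition beta_prec (b c : seq nat) : Prop :=
  part_le (partition_of b) (partition_of c).

Definition st_closed (s t : nat) (b : seq nat) : Prop :=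
  forall x, x \in b ->
    (s < x -> x - s \in b) /\ (t < x -> x - t \in b).

Definition st_closure (s t : nat) (X : {pred nat}) (y : nat) : Prop :=
  exists x a c, [/\ x \in X, a * s + c * t < x & y = x - (a * s + c * t)].

Definition delta_set (s t : nat) (D : seq nat) : Prop :=
  beta_set D /\
  exists2 n, 0 < n & forall y, y \in D <-> st_closure s t (pred1 n) y.

(* Main.v *)
(* Let n be the generator of Delta, S the semigroup generated by s and t, and
   X the ideal of all x in S with n - x <= 0 or n - x in beta. Put
   k = |S \ X| = |Delta| - |beta|. The claim amounts to
   |X n [0, d)| <= |S n [0, d - k)| for every d.
   Writing x = b t + a s, the ideal X is the region a >= h b above a nonincreasing
   staircase with h (b + s) = h b - t, and k is the sum of h over one period.
   Let B be the columns meeting X below d, and r their number per period. The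
   period is cut at a point p where B is densest on all initial segments (cycle
   lemma). Comparing h with its rounded mean over the window [p, p + s) bounds
   |X n [0, d)| as if B consisted of the first r columns of the window, which is
   where t > s enters; since the residues of c t modulo s are distinct, that
   bound is at most the number of elements of S below d - k in r columns. *)
Require Import Defs.
From mathcomp Require Import all_boot all_order all_algebra.
From mathcomp Require Import zify ring.
Import Order.TTheory GRing.Theory Num.Theory.

(** * Inequalities for sums of monotone integer sequences *)

(** Summation by parts turns the expression into the sum of [th x * (z x - z (x - 1))] over
    [1 <= x <= n]. *)
Lemma abel_ge0 (th z : nat -> int) (n : nat) :
  th 0 = 0%R -> (forall x, x <= n -> (0 <= th x)%R) ->
  (forall x, x < n -> (z x <= z x.+1)%R) ->
  (0 <= \sum_(x < n.+1) (th x - th x.+1) * z x + th n.+1 * z n)%R.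
Proof.
move=> th0; elim: n => [|n IHn] thP zP.
  by rewrite big_ord1 th0 /= sub0r mulNr addNr.
rewrite big_ord_recr /=.
have := IHn (fun x xn => thP x (leqW xn)) (fun x xn => zP x (leqW xn)).
have : (0 <= th n.+1 * (z n.+1 - z n))%R.
  by rewrite mulr_ge0 ?thP // subr_ge0 zP.
set S := (\sum_(x < n.+1) _)%R => h1 h2.
have -> : (S + (th n.+1 - th n.+2) * z n.+1 + th n.+2 * z n.+1 =
  (S + th n.+1 * z n) + th n.+1 * (z n.+1 - z n))%R by ring.
exact: addr_ge0.
Qed.

Lemma big_ord_recr_cond (R : Type) (idx : R) (op : Monoid.law idx)
    (n : nat) (P : pred nat) (F : nat -> R) :
  \big[op/idx]_(i < n.+1 | P i) F i =
  op (\big[op/idx]_(i < n | P i) F i) (if P n then F n else idx).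
Proof. by rewrite big_mkcond big_ord_recr -big_mkcond. Qed.

(** If [x] in [B] has [c] elements of [B] below it, then [x] is [c] plus the number of non-members
    below [x]. As [psi] drops by at least 1 per step, the summand at [x] is at most [psi c]. *)
Lemma rank_sum_le (psi : nat -> int) (B : pred nat) (n : nat) :
  (forall x, (psi x.+1 < psi x)%R) ->
  (\sum_(x < n | B x) (psi x + (\sum_(y < x | ~~ B y) 1)%N%:Z)
     <= \sum_(x < \sum_(x < n | B x) 1) psi x)%R.
Proof.
move=> dpsi.
have psi_sub a b : (psi (a + b)%N + b%:Z <= psi a)%R.
  by elim: b => [|b IHb]; rewrite ?addn0 ?addnS; [lia | have := dpsi (a + b); lia].
elim: n => [|n IHn]; first by rewrite !big_ord0.
rewrite (big_ord_recr_cond _ _ _ n B (fun=> 1)).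
rewrite (big_ord_recr_cond _ _ _ n B
  (fun x => psi x + (\sum_(y < x | ~~ B y) 1)%N%:Z)%R) /=.
case: (B n); last by rewrite addr0 addn0.
rewrite addn1 big_ord_recr /=.
apply: lerD => //.
set r := \sum_(x < n | B x) 1; set w := \sum_(x < n | ~~ B x) 1.
have -> : n = r + w.
  rewrite /r /w -[LHS]card_ord -sum1_card (bigID (fun i : 'I_n => B i)) /=.
  by [].
exact: psi_sub.
Qed.

Lemma sum_shift (s : nat) (g : nat -> int) (p : nat) :
  (\sum_(x < s) g (p.+1 + x)%N = \sum_(x < s) g (p + x)%N + (g (p + s)%N - g p))%R.
Proof.
elim: s => [|s IHs]; first by rewrite !big_ord0 addn0 subrr addr0.
by rewrite !big_ord_recr /= IHs addSnnS; ring.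
Qed.

(** * Distinct residues and sums of integer quotients *)

Lemma card_ord_lt_le (r s m : nat) (g : nat -> nat) :
  (forall x y, x < r -> y < r -> g x = g y -> x = y) ->
  \sum_(c < r | g c < m) 1 <= m.
Proof.
move=> gI; rewrite sum1_card -[leqRHS]card_ord.
case: m => [|m]; first by rewrite eq_card0 // => i; rewrite unfold_in.
rewrite -(card_in_imset (f := fun c : 'I_r => inord (g c) : 'I_m.+1)).
  exact: max_card.
move=> x y; rewrite !unfold_in => xm ym /(congr1 val) /=; rewrite !inordK //.
by move=> /gI E; apply/val_inj/E.
Qed.

Lemma Posz_sum (I : Type) (l : seq I) (P : pred I) (F : I -> nat) :
  ((\sum_(i <- l | P i) F i)%N%:Z = \sum_(i <- l | P i) (F i)%:Z)%R.
Proof. exact: (big_morph Posz PoszD). Qed.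

(** Since [t] is invertible modulo [s] and [r <= s], the [r] residues are distinct, so at most
    [s - q] of them lie below [s - q]. *)
Lemma count_modz_ge (u : int) (s t r q : nat) :
  0 < s -> coprime s t -> r <= s -> q <= s ->
  r + q <= s + \sum_(c < r | (s <= `|((u - c%:Z * t%:Z) %% s)%Z|%N + q)%N) 1.
Proof.
move=> s_gt0 st rs qs.
pose g c := `|((u - c%:Z * t%:Z) %% s)%Z|%N.
have gI x y : x < r -> y < r -> g x = g y -> x = y.
  move=> xr yr gxy.
  have /eqP : ((u - x%:Z * t%:Z) %% s = (u - y%:Z * t%:Z) %% s)%Z by rewrite /g in gxy; lia.
  rewrite eqz_mod_dvd.
  have -> : (u - x%:Z * t%:Z - (u - y%:Z * t%:Z) = (y%:Z - x%:Z) * t%:Z)%R by ring.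
  rewrite Gauss_dvdzl; last by rewrite coprimezE.
  move=> /dvdzP [k E].
  have : (k = 0)%R by nia.
  lia.
have := card_ord_lt_le r s (s - q) g gI.
have : r = \sum_(c < r | g c < s - q) 1 + \sum_(c < r | s <= g c + q) 1.
  rewrite -[LHS]card_ord -sum1_card (bigID (fun i : 'I_r => g i < s - q)) /=.
  by congr (_ + _); apply: eq_bigl => i; lia.
rewrite /g; lia.
Qed.

(** Adding [q] raises the quotient by at least one wherever the residue is at least [s - q];
    [count_modz_ge] bounds the number of such [c] from below. *)
Lemma sum_divz_shift (u : int) (s t r q : nat) :
  0 < s -> coprime s t -> r <= s -> q < s -> 
  (\sum_(c < r) ((u - c%:Z * t%:Z) %/ s)%Z + Num.max 0 (q%:Z + r%:Z - s%:Z)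
   <= \sum_(c < r) ((u + q%:Z - c%:Z * t%:Z) %/ s)%Z)%R.
Proof.
move=> s_gt0 st rs qs.
have := count_modz_ge u s t r q s_gt0 st rs (ltnW qs).
set M := \sum_(c < r | _) 1 => HM.
apply: (@le_trans _ _ (\sum_(c < r) ((u - c%:Z * t%:Z) %/ s)%Z + M%:Z)%R); first lia.
rewrite /M Posz_sum [X in (_ + X)%R]big_mkcond -big_split /=.
apply: ler_sum => c _.
set y := (u - _)%R.
have -> : (u + q%:Z - c%:Z * t%:Z = y + q%:Z)%R by rewrite /y; ring.
have := divz_eq y s; have := modz_ge0 y (_ : s%:Z != 0)%R; have := ltz_pmod y (_ : 0 < s%:Z)%R.
move=> /(_ s_gt0) h1 /(_ ltac:(lia)) h2 h3.
by rewrite lez_divRL //; case: ifP => hc; nia.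
Qed.

(** * The inequality over one period of the staircase *)

(* With m the number of x in B such that F x >= 1, each summand dominates z x,
   where z := F - 1 if F >= 1 and min (F + m - 1, 0) otherwise. Since z is
   nondecreasing, [prefix] and Abel summation make the average of z over the
   complement of B at least its average over B, which is nonnegative. *)
Lemma sum_compl_ge0 (s : nat) (B : pred nat) (F : nat -> int) :
  (forall x y, x <= y -> (F x <= F y)%R) ->
  (forall x, x <= s ->
     s * (\sum_(y < x | ~~ B y) 1) <= x * (\sum_(y < s | ~~ B y) 1)) ->
  (1 <= \sum_(x < s | B x) F x)%R ->
  (0 <= \sum_(x < s | ~~ B x)
          (F x - 1 + (\sum_(y < s | B y && (x < y)) 1)%N%:Z))%R.
Proof.
move=> F_nd prefix sumF.
set m := \sum_(x < s | B x && (1 <= F x)%R) 1.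
pose z x : int := (if (1 <= F x)%R then F x - 1 else Num.min (F x + m%:Z - 1) 0)%R.
have z_nd x : (z x <= z x.+1)%R.
  rewrite /z; have := F_nd x x.+1 (leqnSn x).
  by case: ifP; case: ifP; lia.
have m_gt0 : 0 < m.
  rewrite lt0n; apply/negP => /eqP m0.
  suff : (\sum_(x < s | B x) F x <= 0)%R by lia.
  apply: sumr_le0 => x Bx; move/eqP: m0; rewrite sum_nat_eq0.
  by move/forallP/(_ x); rewrite Bx /=; lia.
have zB : (0 <= \sum_(x < s | B x) z x)%R.
  have [/forallP zge0|] := boolP [forall x : 'I_s, B x ==> (0 <= z x)%R].
    by apply: sumr_ge0 => x Bx; have := zge0 x; rewrite Bx.
  rewrite negb_forall => /existsP [x0]; rewrite negb_imply => /andP [Bx0 zx0].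
  (* At [x0] the value of [z] is [F x0 + m - 1], and elsewhere [z] plus the indicator of [1 <= F] is
     at least [F]; removing the [m] indicators leaves at least the sum of [F] minus 1. *)
  have -> : (\sum_(x < s | B x) z x = \sum_(x < s | B x)
      (z x + (if (1 <= F x)%R then 1 else 0)%N%:Z) - m%:Z)%R.
    by rewrite big_split /= -Posz_sum -big_mkcondr addrK.
  move: sumF; rewrite !(bigD1 x0 Bx0) /=.
  have : (\sum_(i < s | B i && (i != x0)) F i <=
     \sum_(i < s | B i && (i != x0))
       (z i + (if (1 <= F i)%R then 1 else 0)%N%:Z))%R.
    by apply: ler_sum => i _; rewrite /z; case: ifP; lia.
  set S1 := (\sum_(i < s | _) F i)%R; set S2 := (\sum_(i < s | _) _)%R.
  have := zx0; rewrite /z; move: m_gt0; clearbody S1 S2 m.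
  by case: ifP => ?; rewrite /=; lia.
have zNB : (0 <= \sum_(x < s | ~~ B x) z x)%R.
  set D := \sum_(y < s | ~~ B y) 1 in prefix.
  have sE : s = \sum_(x < s | B x) 1 + D.
    by rewrite -[LHS]card_ord -sum1_card (bigID (fun i : 'I_s => B i)).
  (* [th] vanishes at 0 and [s] and is nonnegative by [prefix]. Its decrements [s * [x not in B] -
     D] turn Abel summation into [D * SB <= (s - D) * SN]. *)
  pose th x := (x%:Z * D%:Z - s%:Z * (\sum_(y < x | ~~ B y) 1)%N%:Z)%R.
  have thS x : (th x - th x.+1 = (if B x then 0 else s%:Z) - D%:Z)%R.
    rewrite /th (big_ord_recr_cond _ _ _ x (fun y => ~~ B y) (fun=> 1)) /=.
    by case: (B x) => /=; lia.
  have th0 : th 0 = 0%R by rewrite /th big_ord0 mul0r mulr0.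
  have ths : th s = 0%R by rewrite /th mulrC subrr.
  have th_ge0 x : x <= s -> (0 <= th x)%R by move=> /prefix; rewrite /th; lia.
  have : (0 <= \sum_(x < s) (th x - th x.+1) * z x)%R.
    case: (s) ths th_ge0 => [|n] ths th_ge0; first by rewrite big_ord0.
    have := abel_ge0 th z n th0 (fun x xn => th_ge0 x (leqW xn)) (fun x _ => z_nd x).
    by rewrite ths mul0r addr0.
  rewrite (bigID (fun x : 'I_s => B x)) /=.
  have -> : (\sum_(x < s | B x) (th x - th x.+1) * z x =
      - D%:Z * \sum_(x < s | B x) z x)%R.
    by rewrite mulr_sumr; apply: eq_bigr => x Bx; rewrite thS Bx; ring.
  have -> : (\sum_(x < s | ~~ B x) (th x - th x.+1) * z x =
      (s%:Z - D%:Z) * \sum_(x < s | ~~ B x) z x)%R.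
    by rewrite mulr_sumr; apply: eq_bigr => x /negbTE Bx; rewrite thS Bx.
  have : 0 < \sum_(x < s | B x) 1.
    apply: (leq_trans m_gt0); rewrite /m big_mkcondr /=.
    by apply: leq_sum => x _; case: ifP.
  move: zB; set SB := (\sum_(x < s | B x) z x)%R.
  set SN := (\sum_(x < s | ~~ B x) z x)%R => SB_ge0 r_gt0 ineq.
  have r_pos : (0 < s%:Z - D%:Z)%R by lia.
  rewrite -(pmulr_rge0 _ r_pos); apply: (le_trans ineq).
  by rewrite mulNr gerDr oppr_le0 mulr_ge0.
apply: (le_trans zNB); apply: ler_sum => x NBx.
rewrite /z; case: ifP => Fx; first by lia.
(* By monotonicity all [y] with [1 <= F y] lie to the right of [x]. *)
suff : m <= \sum_(y < s | B y && (x < y)) 1 by lia.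
rewrite /m big_mkcond [leqRHS]big_mkcond /=; apply: leq_sum => y _.
case By : (B y) => //=; case: ifP => //= Fy; rewrite ifT // ltnNge.
by apply/negP => /F_nd; lia.
Qed.

(** With [e] the mean of [h] rounded up, the sum of [e - h] over [B] is at most [inv] plus the gain
    [max 0 (q + r - s)]. Moving [B] to the first [r] columns pays for [inv], and passing from [u] to
    [u + q] pays for the gain. *)
Lemma sum_window_le (s t : nat) (B : pred nat) (h : nat -> int) (u : int) :
  0 < s -> s < t -> coprime s t ->
  (forall x, (h x.+1 <= h x)%R) ->
  (forall x, x <= s ->
     s * (\sum_(y < x | ~~ B y) 1) <= x * (\sum_(y < s | ~~ B y) 1)) ->
  (\sum_(x < s | B x) (((u - x%:Z * t%:Z) %/ s)%Z - h x)
    <= \sum_(c < \sum_(x < s | B x) 1)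
         ((u - \sum_(x < s) h x - c%:Z * t%:Z) %/ s)%Z)%R.
Proof.
move=> s_gt0 st co h_ni prefix.
set r := \sum_(x < s | B x) 1; set k := (\sum_(x < s) h x)%R.
set D := \sum_(y < s | ~~ B y) 1 in prefix.
have sE : s = r + D.
  by rewrite -[LHS]card_ord -sum1_card (bigID (fun i : 'I_s => B i)).
have s_neq0 : (s%:Z != 0)%R by lia.
set psi := (fun x : nat => ((u - x%:Z * t%:Z) %/ s)%Z).
(* The numerator drops by [t], hence by at least [s]. *)
have psi_dec x : (psi x.+1 < psi x)%R.
  set y := (u - x.+1%:Z * t%:Z)%R.
  have -> : psi x = ((1 * s%:Z + (u - x%:Z * t%:Z - s%:Z)) %/ s)%Z.
    by rewrite /psi; congr (_ %/ _)%Z; ring.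
  rewrite divzMDl // addrC ltzD1.
  by apply: lez_pdiv2r => //; rewrite /y; lia.
have [q [e [qs kE]]] : exists q : nat, exists e : int,
    q < s /\ k = (s%:Z * e - q%:Z)%R.
  exists `|((- k) %% s)%Z|%N, (- ((- k) %/ s)%Z)%R.
  have := divz_eq (- k) s; have := modz_ge0 (- k) s_neq0.
  have := ltz_pmod (- k) (s_gt0 : (0 < s%:Z)%R).
  by move=> h1 h2 h3; split; lia.
pose F x : int := (e - h x)%R.
have F_nd x y : x <= y -> (F x <= F y)%R.
  move=> /subnKC <-; elim: (y - x) => [|n IHn]; first by rewrite addn0.
  by rewrite addnS; have := h_ni (x + n); rewrite /F in IHn *; lia.
have sumF : (\sum_(x < s) F x = q%:Z)%R.
  by rewrite sumrB sumr_const card_ord -/k kE -mulr_natl natz; lia.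
set inv := \sum_(x < s | B x) (\sum_(y < x | ~~ B y) 1).
(* In the nontrivial case the sum of [F] over the complement is at least [D - inv], while the total
   is [q] and [D = s - r]. *)
have FB_le : (\sum_(x < s | B x) F x <= Num.max 0 (q%:Z + r%:Z - s%:Z) + inv%:Z)%R.
  have [le0|gt0] := lerP (\sum_(x < s | B x) F x)%R 0; first by lia.
  have := sum_compl_ge0 s B F F_nd prefix gt0.
  rewrite big_split sumrB -!Posz_sum -/D /=.
  have -> : \sum_(x < s | ~~ B x) \sum_(y < s | B y && (x < y)) 1 = inv.
    rewrite /inv (exchange_big_dep (fun y : 'I_s => B y)) /=; last first.
      by move=> i j _ /andP [].
    apply: eq_bigr => y By.
    rewrite (big_ord_widen_cond s (fun x => ~~ B x) (fun=> 1)) //; last exact: ltnW.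
    by apply: eq_bigl => x; rewrite By.
  move: sumF; rewrite (bigID (fun x : 'I_s => B x)) /=.
  set SB := (\sum_(x < s | B x) F x)%R; set SN := (\sum_(x < s | ~~ B x) F x)%R.
  by clearbody inv D r SB SN; lia.
have -> : (\sum_(x < s | B x) (psi x - h x) =
    \sum_(x < s | B x) psi x + \sum_(x < s | B x) F x - r%:Z * e)%R.
  rewrite -big_split /r Posz_sum mulr_suml -sumrB /=; apply: eq_bigr => x _.
  by rewrite /F; ring.
have rank := rank_sum_le psi B s psi_dec.
rewrite big_split -Posz_sum -/r -/inv /= in rank.
have r_le : r <= s by rewrite sE leq_addr.
have shift := sum_divz_shift u s t r q s_gt0 co r_le qs.
have -> : (\sum_(c < r) ((u - k - c%:Z * t%:Z) %/ s)%Z =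
    \sum_(c < r) ((u + q%:Z - c%:Z * t%:Z) %/ s)%Z - r%:Z * e)%R.
  rewrite -[X in (X%:Z * e)%R](card_ord r) -sum1_card Posz_sum mulr_suml -sumrB.
  apply: eq_bigr => c _.
  have -> : (u - k - c%:Z * t%:Z = - e * s%:Z + (u + q%:Z - c%:Z * t%:Z))%R.
    by rewrite kE; ring.
  by rewrite divzMDl // mul1r addrC.
rewrite lerD2r; apply: le_trans shift.
apply: (le_trans (lerD (lexx _) FB_le)).
by rewrite addrCA addrC lerD2r.
Qed.

Lemma sum_quasiperiodic (s : nat) (g : nat -> int) (c : int) (p : nat) :
  (forall x, g (x + s) = (g x + c)%R) ->
  (\sum_(x < s) g (p + x)%N = \sum_(x < s) g x + p%:Z * c)%R.
Proof.
move=> gs; elim: p => [|p IHp]; first by rewrite mul0r addr0.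
by rewrite sum_shift IHp gs; lia.
Qed.

(** The summand on the left is periodic, so the period may be cut at any [p]. The cut lowers both
    [u] and the sum of [h] by [p * t], which cancels on the right. *)
Lemma quasiperiodic_core (s t : nat) (h : nat -> int) (u : int) :
  0 < s -> s < t -> coprime s t ->
  (forall x, (h x.+1 <= h x)%R) -> (forall x, h (x + s) = (h x - t%:Z)%R) ->
  (\sum_(x < s) Num.max 0 (((u - x%:Z * t%:Z) %/ s)%Z + 1 - h x)
    <= \sum_(x < s) Num.max 0
         (((u - \sum_(y < s) h y - x%:Z * t%:Z) %/ s)%Z + 1))%R.
Proof.
move=> s_gt0 st co h_ni h_s.
set k := (\sum_(y < s) h y)%R.
have s_neq0 : (s%:Z != 0)%R by lia.
pose w (x : nat) : int := (((u - x%:Z * t%:Z) %/ s)%Z + 1 - h x)%R.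
have w_s x : w (x + s) = w x.
  rewrite /w h_s.
  have -> : (u - (x + s)%N%:Z * t%:Z = - t%:Z * s%:Z + (u - x%:Z * t%:Z))%R.
    by rewrite PoszD; ring.
  by rewrite divzMDl //; ring.
pose B x := (0 < w x)%R.
have B_s x : B (x + s) = B x by rewrite /B w_s.
pose nb x := \sum_(y < x | ~~ B y) 1.
have nbE p x : nb (p + x) = nb p + \sum_(y < x | ~~ B (p + y)) 1.
  by rewrite /nb big_split_ord.
have sum_s (g : nat -> int) p : (forall x, g (x + s) = g x) ->
    (\sum_(x < s) g (p + x)%N = \sum_(x < s) g x)%R.
  move=> gs; rewrite (sum_quasiperiodic s g 0) ?mulr0 ?addr0 // => x.
  by rewrite gs addr0.
have nb_win p : \sum_(y < s | ~~ B (p + y)) 1 = nb s.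
  apply/eqP; rewrite -eqz_nat /nb !Posz_sum big_mkcond [eqbRHS]big_mkcond /=.
  by rewrite (sum_s (fun x => if ~~ B x then 1%:Z else 0)%R) // => x; rewrite B_s.
pose th x : int := (x%:Z * (nb s)%:Z - s%:Z * (nb x)%:Z)%R.
have th_s x : th (x + s) = th x.
  by rewrite /th nbE nb_win; lia.
(* Cycle lemma: at a minimum [p] of the periodic function [th], the inequality [th p <= th (p + x)]
   is the prefix condition. *)
have [p p_min] : exists p, forall x, (th p <= th x)%R.
  have [p _ p_min] := @arg_minP _ _ _ (Ordinal s_gt0) predT (fun i : 'I_s => th i) isT.
  exists p => x; rewrite (divn_eq x s) addnC.
  have -> : th (x %% s + x %/ s * s) = th (x %% s).
    elim: (x %/ s) => [|n IHn]; first by rewrite addn0.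
    by rewrite mulSn addnCA addnC th_s.
  exact: (p_min (Ordinal (ltn_pmod x s_gt0))).
have := sum_window_le s t (fun x => B (p + x)) (fun x => h (p + x))
  (u - p%:Z * t%:Z)%R s_gt0 st co.
have h_ni' x : (h (p + x.+1)%N <= h (p + x)%N)%R by rewrite addnS.
move=> /(_ h_ni') window.
have prefix x : x <= s -> s * (\sum_(y < x | ~~ B (p + y)) 1) <=
    x * (\sum_(y < s | ~~ B (p + y)) 1).
  by move=> _; rewrite nb_win; have := p_min (p + x); rewrite /th nbE; lia.
move: {window}(window prefix); rewrite (sum_quasiperiodic s h (- t%:Z)%R) // -/k.
set r := \sum_(x < s | B (p + x)) 1 => window.
have r_le : r <= s.
  by rewrite /r sum1_card -[leqRHS]card_ord max_card.
have -> : (\sum_(x < s) Num.max 0 (w x) = \sum_(x < s | B (p + x)) w (p + x)%N)%R.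
  rewrite [RHS]big_mkcond (sum_s (fun x => if B x then w x else 0)%R) => [|x].
    by apply: eq_bigr => x _; rewrite /B; case: ifP; lia.
  by rewrite B_s w_s.
have -> : (\sum_(x < s | B (p + x)) w (p + x)%N = \sum_(x < s | B (p + x))
    (((u - p%:Z * t%:Z - x%:Z * t%:Z) %/ s)%Z - h (p + x)%N) + r%:Z)%R.
  rewrite /r Posz_sum -big_split; apply: eq_bigr => x _ /=.
  rewrite /w; have -> : (u - (p + x)%N%:Z * t%:Z = u - p%:Z * t%:Z - x%:Z * t%:Z)%R.
    by rewrite PoszD; ring.
  by ring.
apply: (@le_trans _ _ (\sum_(c < r) (((u - k - c%:Z * t%:Z) %/ s)%Z + 1))%R).
  have rE : (r%:Z = \sum_(c < r) 1)%R by rewrite -{1}(card_ord r) -sum1_card Posz_sum.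
  rewrite [leRHS]big_split /=; apply: lerD; last by rewrite rE.
  apply: (le_trans window); rewrite le_eqVlt; apply/orP; left; apply/eqP.
  by apply: eq_bigr => c _; congr (_ %/ _)%Z; ring.
(* Each of the [r] terms is at most its positive part, and the other columns of the period
   contribute nonnegative terms. *)
rewrite (big_ord_widen s (fun x => ((u - k - x%:Z * t%:Z) %/ s)%Z + 1)%R r_le).
rewrite big_mkcond /=; apply: ler_sum => x _.
by case: ifP => _; rewrite le_max lexx ?orbT.
Qed.

(** * Counting by thresholds and by columns *)

(** In a decreasing list the entries above [e] form an initial segment. Past the end, the default 0
    is never above [e]. *)
Lemma nth_gt_count (e : nat) (l : seq nat) (i : nat) :
  sorted gtn l -> (i < count (ltn e) l) = (e < nth 0 l i).
Proof.
elim: l i => [|x l IHl] i /=; first by move=> _; rewrite nth_nil.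
rewrite path_sortedE => [/andP [x_max l_sorted]|a b c /= ab bc]; last exact: ltn_trans bc ab.
case: i => [|i] /=; last first.
  rewrite -IHl //; case: (ltnP e x) => //= xe.
  rewrite (_ : count _ l = 0) //; apply/eqP; rewrite -leqn0 leqNgt -has_count.
  by apply/hasPn => y /(allP x_max) /=; lia.
case: (ltnP e x) => //= xe; rewrite add0n.
rewrite (_ : count _ l = 0) //; apply/eqP; rewrite -leqn0 leqNgt -has_count.
by apply/hasPn => y /(allP x_max) /=; lia.
Qed.

Lemma sum_ord_interval (n lo m : nat) :
  \sum_(a < n | (a < m) && (lo <= a)) 1 = minn m n - lo.
Proof.
elim: n => [|n IHn]; first by rewrite big_ord0; lia.
rewrite (big_ord_recr_cond _ _ _ n (fun a => (a < m) && (lo <= a)) (fun=> 1)) /= IHn.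
by case: ifP; lia.
Qed.

(** The first condition reads [a < M] with [M] the quotient plus one; [m <= n] ensures [M <= n], so
    the range of [a] cuts nothing off. *)
Lemma count_progression (s b lo n : nat) (m : int) :
  0 < s -> (m <= n%:Z)%R ->
  ((\sum_(a < n | ((b + a * s)%N%:Z < m)%R && (lo <= a)%N) 1)%:Z
    = Num.max 0 (((m - 1 - b%:Z) %/ s)%Z + 1 - lo%:Z))%R.
Proof.
move=> s_gt0 mn; pose M : int := (((m - 1 - b%:Z) %/ s)%Z + 1)%R.
have ltM (a : nat) : ((b + a * s)%N%:Z < m)%R = (a%:Z < M)%R.
  by rewrite /M ltzD1 lez_divRL //; lia.
have Mn : (M <= n%:Z)%R.
  by rewrite leNgt -ltM; apply/negP; nia.
rewrite (eq_bigl (fun a : 'I_n => (a < `|Num.max 0%R M|%N) && (lo <= a))) => [|a].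
  by rewrite sum_ord_interval -/M; lia.
by rewrite ltM; lia.
Qed.

Lemma modn_mull_inj (s t b b' : nat) :
  coprime s t -> b < s -> b' < s -> b * t = b' * t %[mod s] -> b = b'.
Proof.
move=> st; wlog le : b b' / b' <= b.
  move=> H bs b's E; case/orP: (leq_total b' b) => le; first exact: H.
  by apply/esym/H.
move=> bs b's /eqP; rewrite eqn_mod_dvd ?leq_mul2r ?le ?orbT // -mulnBl Gauss_dvdl //.
by case: (posnP (b - b')) => [|gt0 /(dvdn_leq gt0)]; lia.
Qed.

(** Reducing [c] modulo [s] moves multiples of [s * t] into the [s] part, so each entry has a
    representation with [b < s]; it is unique because [t] is invertible modulo [s]. *)
Lemma count_columns (s t n : nat) (l : seq nat) (p : pred nat) :
  0 < s -> coprime s t -> uniq l ->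
  (forall y, y \in l -> exists a c, a * s + c * t < n /\ y = n - (a * s + c * t)) ->
  count p l = \sum_(b < s) \sum_(a < n | [&& b * t + a * s < n,
    n - (b * t + a * s) \in l & p (n - (b * t + a * s))]) 1.
Proof.
move=> s_gt0 st l_uniq l_rep.
rewrite pair_big_dep sum1_card cardE -size_filter /=.
pose f (z : 'I_s * 'I_n) := n - (z.1 * t + z.2 * s).
rewrite -(size_map f); apply: perm_size; apply: uniq_perm.
- exact: filter_uniq.
- rewrite map_inj_in_uniq ?enum_uniq // => [[b a] [b' a']].
  rewrite !mem_enum !unfold_in /= /f /= => /and3P [lt1 _ _] /and3P [lt2 _ _] eq_n.
  have E : b * t + a * s = b' * t + a' * s by lia.
  have bt : b * t == b' * t %[mod s] by rewrite -(modnMDl a) addnC E addnC modnMDl.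
  have bb' : b = b' :> nat.
    exact: (modn_mull_inj s t _ _ st (valP b) (valP b') (eqP bt)).
  congr pair; apply: val_inj => //=; nia.
- move=> y; rewrite mem_filter; apply/andP/mapP => [[py yl]|[[b a]]].
    have [a [c [lt_n yE]]] := l_rep y yl.
    have ac : a * s + c * t = c %% s * t + (a + c %/ s * t) * s.
      by rewrite {1}(divn_eq c s); lia.
    have an : a + c %/ s * t < n by nia.
    exists (Ordinal (ltn_pmod c s_gt0), Ordinal an); last by rewrite /f /= -ac.
    by rewrite mem_enum unfold_in /= -ac lt_n -yE yl.
  by rewrite mem_enum unfold_in /= => /and3P [_ fl pf] ->.
Qed.

(** * The staircase of an ideal and the comparison of counts *)

(** The least height [h0 b] is truncated at 0, so it need not drop by [t] over a period. The integer
    function [h] extends the first period of [h0] without truncation. *)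
Lemma ideal_columns (s t : nat) (P : nat -> nat -> bool) :
  0 < s ->
  (forall b, exists a, P b a) ->
  (forall b a, P b a -> P b a.+1) -> (forall b a, P b a -> P b.+1 a) ->
  (forall b a, P (b + s) a = P b (a + t)) ->
  exists h : nat -> int, exists h0 : nat -> nat,
    [/\ forall b, b < s -> h b = Posz (h0 b), forall b a, P b a = (h0 b <= a),
        forall b, (h b.+1 <= h b)%R & forall b, h (b + s) = (h b - t%:Z)%R].
Proof.
move=> s_gt0 exP upP rightP wrapP.
pose h0 b := ex_minn (exP b).
have h0P b a : P b a = (h0 b <= a).
  rewrite /h0; case: ex_minnP => m Pm m_min; apply/idP/idP; first exact: m_min.
  by move=> /subnKC <-; elim: (a - m) => [|n IHn]; rewrite ?addn0 ?addnS //; exact: upP.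
exists (fun b : nat => Posz (h0 (b %% s)%N) - Posz (b %/ s * t)%N)%R, h0; split => // b.
- by move=> bs; rewrite modn_small // divn_small // mul0n subr0.
- have := ltn_pmod b s_gt0; have := divn_eq b s.
  set q := b %/ s; set c := b %% s => bE cs.
  have -> : b.+1 = q * s + c.+1 by rewrite bE addnS.
  rewrite modnMDl divnMDl //.
  have [cs'|sc] := ltnP c.+1 s.
    rewrite modn_small // (divn_small cs') addn0.
    have := rightP c (h0 c); rewrite !h0P leqnn => /(_ isT); lia.
  (* At the end of a period, column [s] is column 0 lowered by [t], whence [h0 0 - t <= h0 c]. *)
  have cE : c.+1 = 0 + s by lia.
  have := rightP c (h0 c); rewrite cE wrapP !h0P leqnn => /(_ isT).
  by rewrite modnDr mod0n add0n divnn s_gt0 mulnDl; lia.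
- by rewrite modnDr -[X in (_ + X) %/ _]mul1n addnC divnMDl // mulnDl; lia.
Qed.

(** This is the inequality for [d = n - e]: elements above [e] correspond to [x < d]. Both counts
    are split into columns and compared with [u = d - 1]. *)
Lemma count_gt_le (s t n : nat) (Delta beta : seq nat) :
  0 < s -> s < t -> coprime s t ->
  beta_set Delta -> beta_set beta -> st_closed s t beta ->
  (forall y, y \in Delta <-> st_closure s t (pred1 n) y) ->
  {subset beta <= Delta} ->
  forall e, count (ltn e) beta <= count (ltn (e + (size Delta - size beta))) Delta.
Proof.
move=> s_gt0 st co /andP [D_sorted _] /andP [b_sorted b_pos] b_closed DP sub e.
have uniq_gt l : sorted gtn l -> uniq l.
  by apply: sorted_uniq => [a b c /= ab bc|a]; [exact: ltn_trans bc ab | rewrite /= ltnn].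
have D_rep y : y \in Delta -> exists a c, a * s + c * t < n /\ y = n - (a * s + c * t).
  by move=> /DP [x [a [c [/eqP -> lt yE]]]]; exists a, c.
have D_mem a b : b * t + a * s < n -> n - (b * t + a * s) \in Delta.
  by rewrite addnC => lt; apply/DP; exists n, a, b; split => //; exact: eqxx.
(* Including 0 makes every point with [n <= b * t + a * s] belong to the ideal, through truncated
   subtraction. *)
pose Q y := (y == 0) || (y \in beta).
have Qsub r y : (forall x, x \in beta -> r < x -> x - r \in beta) -> Q y -> Q (y - r).
  move=> cl; rewrite /Q => /orP [/eqP -> //|yb].
  by case: (ltnP r y) => [ry|/eqP -> //]; rewrite cl ?orbT.
have Qs y : Q y -> Q (y - s) by apply: Qsub => x /b_closed [].
have Qt y : Q y -> Q (y - t) by apply: Qsub => x /b_closed [].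
pose P b a := Q (n - (b * t + a * s)).
have [h [h0 [hE PE h_ni h_s]]] : exists h : nat -> int, exists h0 : nat -> nat,
    [/\ forall b, b < s -> h b = Posz (h0 b), forall b a, P b a = (h0 b <= a),
        forall b, (h b.+1 <= h b)%R & forall b, h (b + s) = (h b - t%:Z)%R].
  apply: ideal_columns => // [b|b a /Qs|b a /Qt|b a]; rewrite /P.
  - by exists n; rewrite /Q (_ : n - _ = 0) //; nia.
  - by rewrite -subnDA mulSn addnA addnAC.
  - by rewrite -subnDA mulSn addnAC [t + _]addnC.
  - by congr (Q (n - _)); lia.
have mem_b b a : b * t + a * s < n -> (n - (b * t + a * s) \in beta) = (h0 b <= a).
  by move=> lt; rewrite -PE /P /Q subn_eq0 leqNgt lt.
have countD := count_columns s t n Delta _ s_gt0 co (uniq_gt _ D_sorted) D_rep.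
have countb := count_columns s t n beta _ s_gt0 co (uniq_gt _ b_sorted)
  (fun y yb => D_rep y (sub y yb)).
have col_b (m : nat) : ((count (ltn m) beta)%:Z = \sum_(b < s)
    Num.max 0 (((n%:Z - m%:Z - 1 - b%:Z * t%:Z) %/ s)%Z + 1 - h b))%R.
  rewrite countb Posz_sum; apply: eq_bigr => b _; rewrite hE //.
  rewrite -PoszM -(count_progression s _ _ n) //; last by lia.
  congr Posz; apply: eq_bigl => a; rewrite /=.
  case: (ltnP (b * t + a * s) n) => /= lt; last by lia.
  by rewrite mem_b //; lia.
have col_D (m : nat) : ((count (ltn m) Delta)%:Z = \sum_(b < s)
    Num.max 0 (((n%:Z - m%:Z - 1 - b%:Z * t%:Z) %/ s)%Z + 1))%R.
  rewrite countD Posz_sum; apply: eq_bigr => b _.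
  rewrite -[X in Num.max 0%R X]subr0 -PoszM -(count_progression s _ 0 n) //; last by lia.
  congr Posz; apply: eq_bigl => a; rewrite /=.
  case: (ltnP (b * t + a * s) n) => /= lt; last by lia.
  by rewrite D_mem //; lia.
have h0n b : h0 b <= n by rewrite -PE /P /Q (_ : n - _ = 0) //; nia.
(* In column [b] the elements of [Delta] missing from [beta] are those with [a < h0 b]. *)
have kE : size Delta = size beta + \sum_(b < s) h0 b.
  rewrite -!(count_predT) countD countb -big_split /=; apply: eq_bigr => b _.
  have -> : h0 b = \sum_(a < n | (a < h0 b) && (0 <= a)) 1.
    by rewrite sum_ord_interval subn0 (minn_idPl (h0n b)).
  rewrite !(big_mkcond (fun a : 'I_n => _ && _)) -big_split /=; apply: eq_bigr => a _.
  case: (ltnP (b * t + a * s) n) => /= lt.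
    by rewrite D_mem //= mem_b //; case: leqP.
  rewrite ltnNge -PE /P /Q (_ : n - _ = 0) //; lia.
have := quasiperiodic_core s t h (n%:Z - e%:Z - 1)%R s_gt0 st co h_ni h_s.
rewrite -lez_nat col_b col_D.
have -> : (\sum_(y < s) h y = (\sum_(y < s) h0 y)%N%:Z)%R.
  by rewrite Posz_sum; apply: eq_bigr => y _; exact: hE.
have -> : size Delta - size beta = \sum_(y < s) h0 y by rewrite kE addKn.
move=> core; apply: (le_trans core); rewrite le_eqVlt; apply/orP; left; apply/eqP.
apply: eq_bigr => x _; congr (Num.max _ ((_ %/ _)%Z + _))%R.
by rewrite PoszD; ring.
Qed.

(** * From counts to entries of the partitions *)

Theorem theorem3p2 (s t : nat) (Delta beta : seq nat) :
  0 < s -> s < t -> coprime s t ->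
  delta_set s t Delta -> st_closed s t Delta ->
  beta_set beta -> st_closed s t beta ->
  {subset beta <= Delta} ->
  beta_prec beta Delta.
Proof.
move=> s_gt0 st co [D_set [n _ DP]] _ b_set b_closed sub.
have [D_sorted _] := andP D_set; have [b_sorted b_pos] := andP b_set.
have b_uniq : uniq beta.
  apply: sorted_uniq b_sorted => [a b c /= ab bc|a]; [exact: ltn_trans bc ab | by rewrite /= ltnn].
have size_le : size beta <= size Delta by exact: uniq_leq_size.
split; rewrite !size_mkseq // => i ib.
rewrite !nth_mkseq //; last exact: leq_trans ib size_le.
set x := nth 0 beta i.
have x_gt0 : 0 < x by apply: (allP b_pos); exact: mem_nth.
(* The threshold [x - 1] counts [x] itself. The resulting bound, that entry [i] of [Delta] is at
   least [x + (size Delta - size beta)], is the claim, as the subtracted offsets differ by exactly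
   this amount. *)
have : i < count (ltn x.-1) beta by rewrite nth_gt_count // prednK.
move=> /leq_trans /(_ (count_gt_le _ _ _ _ _ s_gt0 st co D_set b_set b_closed DP sub _)).
by rewrite nth_gt_count //; lia.
Qed.
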